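(* Let $\mathsf{T}$ be a rooted plane tree with $n\geq 2$ nodes and root $\mathfrak{r}$. Then \[\max_{\delta\in\mathcal{O}(\mathsf{T})}|\mathrm{Orb}_{\mathsf{Pop}}(\delta)|=\max_{C\in\mathcal{M}_{\mathsf{T}}}\ \min_{v\in C\setminus\{\mathfrak{r}\}}\bigl(|\Delta_\mathsf{T}(v)|+2\,\mathrm{depth}_\mathsf{T}(v)-1\bigr).\]
   Context: A rooted plane tree $\mathsf{T}$ is a finite tree with a distinguished root $\mathfrak{r}$, regarded as a poset $\leq_\mathsf{T}$ in which $v'\leq_\mathsf{T} v$ iff $v$ lies on the path from $v'$ to $\mathfrak{r}$ (so $\mathfrak{r}$ is the maximum and every non-root node is covered by exactly one node, its parent). For $v\in\mathsf{T}$, $\Delta_\mathsf{T}(v)=\{v'\in\mathsf{T}:v'\leq_\mathsf{T} v\}$ and $\nabla_\mathsf{T}(v)=\{v'\in\mathsf{T}:v\leq_\mathsf{T} v'\}$; $\mathrm{depth}_\mathsf{T}(v)=|\nabla_\mathsf{T}(v)|-1$. $\mathcal{M}_\mathsf{T}$ is the set of maximal chains of the poset $\mathsf{T}$ (i.e., paths from a leaf to the root). An ornament of $\mathsf{T}$ is a nonempty set of nodes inducing a connected subgraph. An ornamentation of $\mathsf{T}$ is a map $\delta$ from $\mathsf{T}$ to ornaments such that (1) for every $v$, the unique maximal element of $\delta(v)$ is $v$; (2) for all $v,v'$, the sets $\delta(v),\delta(v')$ are either nested (one contains the other) or disjoint. $\mathcal{O}(\mathsf{T})$ is the set of ornamentations,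 partially ordered by $\delta\leq\delta'$ iff $\delta(v)\subseteq\delta'(v)$ for all $v$; this is a lattice with meet $(\delta\wedge\delta')(v)=\delta(v)\cap\delta'(v)$. The pop-stack operator $\mathsf{Pop}\colon\mathcal{O}(\mathsf{T})\to\mathcal{O}(\mathsf{T})$ is $\mathsf{Pop}(\delta)=\bigwedge(\{\delta\}\cup\{\delta':\delta'\lessdot\delta\})$, where $\lessdot$ is the cover relation. $\mathrm{Orb}_{\mathsf{Pop}}(\delta)=\{\delta,\mathsf{Pop}(\delta),\mathsf{Pop}^2(\delta),\dots\}$ is the forward orbit. *)

(* Defs.v *)
(* A rooted tree on a finite type T is given by a parent map
   [par : T -> T] with [par r = r] and every node reaching [r] by iterating
   [par]. *)
From mathcomp Require Import all_boot.
Set Implicit Arguments. Unset Strict Implicit. Unset Printing Implicit Defensive.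

Section Tree.
Variables (T : finType) (r : T) (par : T -> T).

Definition tle (v' v : T) : bool := fconnect par v' v.

Definition Delta (v : T) : {set T} := [set v' | tle v' v].
Definition Nabla (v : T) : {set T} := [set v' | tle v v'].
Definition depth (v : T) : nat := #|Nabla v| - 1.

Definition is_chain (C : {set T}) : bool :=
  [forall x in C, forall y in C, tle x y || tle y x].
Definition is_maxchain (C : {set T}) : bool :=
  is_chain C && [forall D : {set T}, (is_chain D && (C \subset D)) ==> (D == C)].

Definition adj (x y : T) : bool := (x != y) && ((par x == y) || (par y == x)).

Definition is_ornament (S : {set T}) : bool :=
  (S != set0) &&
  [forall x in S, forall y in S,
      connect [rel a b | [&& a \in S, b \in S & adj a b]] x y].

Definition maxel (S : {set T}) : {set T} :=
  [set u in S | [forall w in S, tle u w ==> (w == u)]].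

Definition is_ornamentation (d : {ffun T -> {set T}}) : bool :=
  [forall v, is_ornament (d v)] &&
  [forall v, maxel (d v) == [set v]] &&
  [forall v, forall v',
      [|| d v \subset d v', d v' \subset d v | [disjoint d v & d v']]].

Definition orn_le (d d' : {ffun T -> {set T}}) : bool :=
  [forall v, d v \subset d' v].

Definition orn_lt (d d' : {ffun T -> {set T}}) : bool :=
  orn_le d d' && (d != d').

Definition orn_cover (d' d : {ffun T -> {set T}}) : bool :=
  [&& is_ornamentation d', is_ornamentation d, orn_lt d' d &
      [forall e : {ffun T -> {set T}},
          ~~ [&& is_ornamentation e, orn_lt d' e & orn_lt e d]]].

(* pop-stack operator: meet (pointwise intersection) of d and its lower covers *)
Definition Pop (d : {ffun T -> {set T}}) : {ffun T -> {set T}} :=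
  [ffun v => d v :&: \bigcap_(d' | orn_cover d' d) d' v].

Definition orbit_pop (d : {ffun T -> {set T}}) : {set {ffun T -> {set T}}} :=
  [set e | fconnect Pop d e].

(* minimum of f over a set A (the seed is an upper bound, so this is the
   genuine minimum when A is nonempty) *)
Definition min_over (A : {set T}) (f : T -> nat) : nat :=
  \big[minn/ \max_(v in A) f v]_(v in A) f v.

End Tree.

(* Main.v *)
(* A lower cover of d removes from some d v one leaf block: a maximal d u inside
   d v minus its root with nothing of d v below it except itself.  Hence Pop
   removes from every d v all of its leaf blocks.

   Upper bound.  Let u < w.  At every step d w loses an element below u, unless
   d w and some d y with u < y < w agree below u; by induction on time, u has
   left d w after |Delta u| + (depth u - depth w) - 1 steps.  Let N be the right-hand
   side.  Every leaf has an ancestor-or-self a <> r with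
   |Delta a| + 2 depth a - 1 <= N; moving up from the highest such nodes, v leaves
   d w by time N - depth v - depth w, because once all children of v have left,
   v is a leaf block of its own.  So N - 1 steps lead to the bottom element.

   Lower bound.  Along a chain ending at a leaf, build d with d v surviving k
   steps and |d v| <= k + 1, by induction from the child c of v to v with k
   increased by 2: take d v := {v, y} u d c with y a child of d c inside Delta c.
   As long as d c loses something at each step, d v keeps properly containing it,
   which delays the removal of c by two further steps. *)
Require Import Defs.
From mathcomp Require Import all_boot.
From mathcomp Require Import zify.
Set Implicit Arguments. Unset Strict Implicit. Unset Printing Implicit Defensive.

(** * The tree order, depth and sizes of lower sets *)

Section TreeOrder.
Variables (T : finType) (r : T) (par : T -> T).
Hypotheses (Hroot : par r = r) (Htree : forall v : T, fconnect par v r).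

Local Notation le := (tle par).
Local Notation Dl := (Delta par).
Local Notation dp := (depth par).

Lemma tleP x y : reflect (exists n, y = iter n par x) (le x y).
Proof.
apply: (iffP idP) => [h | [n ->]]; last exact: fconnect_iter.
by exists (findex par x y); rewrite iter_findex.
Qed.

Lemma tle_refl x : le x x. Proof. exact: connect0. Qed.

Lemma tle_trans y x z : le x y -> le y z -> le x z.
Proof. exact: connect_trans. Qed.

Lemma tle_par x : le x (par x). Proof. exact: fconnect1. Qed.

Lemma tle_eqVpar x y : le x y = (x == y) || le (par x) y.
Proof. exact: fconnect_eqVf. Qed.

Lemma iter_root n : iter n par r = r.
Proof. by elim: n => //= n ->. Qed.

Lemma tle_root x : le r x -> x = r.
Proof. by move/tleP=> [n ->]; rewrite iter_root. Qed.

(** If both relations hold, [x] is periodic under [par]. With a positive period, iterating long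
    enough reaches the fixed point [r], so [x = r] and hence [y = r]. *)
Lemma tle_anti x y : le x y -> le y x -> x = y.
Proof.
move=> /tleP [m ey] /tleP [n ex].
have per k : iter (k * (n + m)) par x = x.
  by elim: k => // k IH; rewrite mulSn iterD IH iterD -ey -ex.
case: (posnP (n + m)) => [nm0 | nm_gt0].
  by move: ey; rewrite (_ : m = 0)//; lia.
have xr : x = r.
  have /tleP [k er] := Htree x.
  have le_k : k <= k * (n + m) by rewrite leq_pmulr.
  by rewrite -(per k) -(subnK le_k) iterD -er iter_root.
by rewrite ey xr iter_root.
Qed.

Lemma tle_up_total x y z : le x y -> le x z -> le y z || le z y.
Proof.
move=> /tleP [m ->] /tleP [n ->].
case: (leqP m n) => [mn | /ltnW nm]; apply/orP; [left | right]; apply/tleP.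
  by exists (n - m); rewrite -iterD subnK.
by exists (m - n); rewrite -iterD subnK.
Qed.

Lemma tle_child x v : le x v -> x != v ->
  exists c, [/\ par c = v, c != v & le x c].
Proof.
move=> /tleP [n ->]; elim: n => [|n IH] /=; first by rewrite eqxx.
case: (eqVneq (iter n par x) (par (iter n par x))) => [<- // | ne _].
by exists (iter n par x); split=> //; apply/tleP; exists n.
Qed.

Lemma tle_below_child c y : le c y -> y != c -> le (par c) y.
Proof. by rewrite tle_eqVpar eq_sym => /orP [/eqP -> | //]; rewrite eqxx. Qed.

Lemma depth_lt x y : le x y -> x != y -> dp y < dp x.
Proof.
move=> lxy nxy.
have y_gt0 : 0 < #|Nabla par y|.
  by apply/card_gt0P; exists y; rewrite inE tle_refl.
have: #|Nabla par y| < #|Nabla par x|; last by rewrite /depth; lia.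
apply: proper_card; apply/properP; split.
  by apply/subsetP=> z; rewrite !inE; apply: tle_trans.
exists x; rewrite !inE ?tle_refl //.
by apply: contra nxy => lyx; rewrite (tle_anti lxy lyx).
Qed.

Lemma depth_child c : c != par c -> dp c = (dp (par c)).+1.
Proof.
move=> nc; rewrite /depth.
have -> : Nabla par c = c |: Nabla par (par c).
  by apply/setP=> y; rewrite !inE tle_eqVpar eq_sym.
have p_gt0 : 0 < #|Nabla par (par c)|.
  by apply/card_gt0P; exists (par c); rewrite inE tle_refl.
rewrite cardsU1 inE (_ : le (par c) c = false) /=; first by lia.
by apply: contra_neqF nc => h; apply: tle_anti h; apply: tle_par.
Qed.

Lemma par_neq x : x != r -> x != par x.
Proof.
apply: contra_neq => xp; have /tleP [n ->] := Htree x.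
by elim: n => //= n <-.
Qed.

Lemma depth_root : dp r = 0.
Proof.
rewrite /depth (_ : Nabla par r = [set r]) ?cards1 //.
apply/setP=> y; rewrite !inE; apply/idP/eqP => [/tle_root // | ->].
exact: tle_refl.
Qed.

Lemma depth_gt0 v : v != r -> 0 < dp v.
Proof. by rewrite -depth_root; apply: depth_lt; apply: Htree. Qed.

Lemma tle_lt_neq_root x v : le x v -> x != v -> x != r.
Proof. by move=> lxv; apply: contra_neq => xr; move: lxv; rewrite xr => /tle_root. Qed.

Lemma card_Delta_gt0 v : 0 < #|Dl v|.
Proof. by apply/card_gt0P; exists v; rewrite inE tle_refl. Qed.

Lemma card_Delta_lt x v : le x v -> x != v -> #|Dl x| < #|Dl v|.
Proof.
move=> lxv nxv; apply: proper_card; apply/properP; split.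
  by apply/subsetP=> z; rewrite !inE => lzx; apply: tle_trans lxv.
exists v; rewrite !inE ?tle_refl //.
by apply: contra nxv => lvx; rewrite (tle_anti lxv lvx).
Qed.

(** * Ornaments and ornamentations through closure under parents *)

Definition rooted_ornament (v : T) (S : {set T}) : Prop :=
  [/\ v \in S, (forall x, x \in S -> le x v) &
      (forall x, x \in S -> x != v -> par x \in S)].

Lemma rooted_ornament_up v S x y :
  rooted_ornament v S -> x \in S -> le x y -> le y v -> y \in S.
Proof.
move=> [vS Sv Sp] xS /tleP [n ->].
elim: n => //= n IH lv.
have xnS : iter n par x \in S by apply: IH; apply: tle_trans lv; apply: tle_par.
case: (eqVneq (iter n par x) v) => [e | ]; last exact: Sp.
by rewrite (tle_anti lv) // -{1}e tle_par.
Qed.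

(** In a tree, connectedness with top [v] amounts to every node of [S] climbing to [v] inside
    [S]. *)
Lemma rooted_ornamentE v S :
  rooted_ornament v S <-> is_ornament par S /\ maxel par S == [set v].
Proof.
set e := [rel a b | [&& a \in S, b \in S & adj par a b]].
split=> [H | [/andP [Sn0 /forallP Scon] /eqP Smax]].
  have [vS Sv Sp] := H; split; last first.
    apply/eqP/setP=> u; rewrite !inE; apply/andP/eqP => [[uS /forallP mu] | ->].
      by have := mu v; rewrite vS Sv //= => /eqP.
    split=> //; apply/forallP=> w; apply/implyP=> wS; apply/implyP=> lvw.
    by rewrite (tle_anti lvw (Sv _ wS)).
  apply/andP; split; first by apply/set0Pn; exists v.
  have esym : connect_sym e.
    apply: sym_connect_sym => a b; rewrite /= /adj andbCA eq_sym.
    by rewrite [(par a == b) || _]orbC.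
  have conv x : x \in S -> connect e x v.
    move=> xS; have /tleP [n ev] := Sv _ xS.
    elim: n x xS ev => [|n IH] x xS ev; first by rewrite ev connect0.
    case: (eqVneq x v) => [-> | nxv]; first exact: connect0.
    have pS := Sp _ xS nxv.
    case: (eqVneq (par x) x) => [e1 | np].
      by apply: IH => //; rewrite ev iterSr e1.
    apply: (@connect_trans _ _ (par x)); last by apply: IH => //; rewrite ev iterSr.
    by apply: connect1; rewrite /= xS pS /adj eq_sym np eqxx.
  apply/forallP=> x; apply/implyP=> xS; apply/forallP=> y; apply/implyP=> yS.
  by apply: connect_trans (conv _ xS) _; rewrite esym conv.
have vS : v \in S by have := set11 v; rewrite -Smax inE => /andP [].
have Sv x : x \in S -> le x v.
  (* A node of [S] above [x] of least depth is maximal in [S], hence is [v]. *)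
  move=> xS; pose P := [pred y | (y \in S) && le x y].
  have Px : P x by rewrite /= xS tle_refl.
  case: (arg_minnP dp Px) => y /andP [yS lxy] ymin.
  suff: y \in maxel par S by rewrite Smax inE => /eqP <-.
  rewrite inE yS; apply/forallP=> w; apply/implyP=> wS; apply/implyP=> lyw.
  apply/negPn/negP; rewrite eq_sym => /(depth_lt lyw); rewrite ltnNge ymin //=.
  by rewrite wS (tle_trans lxy).
split=> // x xS nxv; apply/negPn/negP => npS.
(* The only edge out of [Delta x] joins [x] to [par x], which is outside [S]; a path in [S] from [x]
   therefore stays below [x]. *)
have stay a b : le a x -> connect e a b -> le b x.
  move=> lax /connectP [p ep ->]; elim: p a lax ep => //= b' p IH a lax.
  case/andP=> /and3P [aS bS /andP [_ /orP [/eqP pab | /eqP pba]]]; apply: IH.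
    apply: contraTT bS => lbx; rewrite -pab.
    by move: lax; rewrite tle_eqVpar => /orP [/eqP -> // | ]; rewrite pab (negPf lbx).
  by rewrite tle_eqVpar pba lax orbT.
have lvx : le v x.
  apply: stay (tle_refl x) _.
  by have := Scon x; rewrite xS => /forallP /(_ v); rewrite vS.
by move: nxv; rewrite (tle_anti lvx (Sv _ xS)) eqxx.
Qed.

Definition ornamentation (d : {ffun T -> {set T}}) : Prop :=
  (forall v, rooted_ornament v (d v)) /\ (forall x v, x \in d v -> d x \subset d v).

(** If [x] is in [d v], the two sets meet, and [d v] inside [d x] forces [x = v]. Conversely, two
    sets sharing an element have comparable tops, and the lower top lies in the other set. *)
Lemma ornamentationP d : reflect (ornamentation d) (is_ornamentation par d).
Proof.
apply: (iffP andP) => [[/andP [/forallP dorn /forallP dmax] dnest] | [dro dsub]].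
  have dro v : rooted_ornament v (d v) by apply/rooted_ornamentE; split.
  split=> // x v xv; have [xx xD _] := dro x; have [vv vD _] := dro v.
  have /forallP /(_ v) /or3P [// | vx | dis] := forallP dnest x.
    by rewrite (tle_anti (vD _ xv) (xD _ (subsetP vx _ vv))).
  by move: (disjointFr dis xx); rewrite xv.
split.
  apply/andP; split; apply/forallP=> v; by have /rooted_ornamentE [] := dro v.
apply/forallP=> v; apply/forallP=> w.
case: (boolP [disjoint d v & d w]) => [_ | ]; first by rewrite !orbT.
rewrite -setI_eq0 => /set0Pn [x /setIP [xv xw]].
have [_ vD _] := dro v; have [_ wD _] := dro w.
have /orP [lvw | lwv] := tle_up_total (vD _ xv) (wD _ xw).
  by rewrite dsub //; apply: rooted_ornament_up (dro w) xw (vD _ xv) lvw.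
by rewrite [d w \subset d v]dsub ?orbT //; apply: rooted_ornament_up (dro v) xv (wD _ xw) lwv.
Qed.

(** * Leaf blocks, lower covers and the action of [Pop] *)

Definition leaf_block (d : {ffun T -> {set T}}) (v u : T) : Prop :=
  [/\ u \in d v, u != v, (forall y, y \in d v -> le y u -> y \in d u) &
      (forall w, w \in d v -> w != v -> u \in d w -> w = u)].

Definition remove_block (d : {ffun T -> {set T}}) (v u : T) : {ffun T -> {set T}} :=
  [ffun w => if w == v then d v :\: d u else d w].

Lemma orn_self d v : ornamentation d -> v \in d v.
Proof. by move=> [/(_ v) []]. Qed.

Lemma orn_le_top d v x : ornamentation d -> x \in d v -> le x v.
Proof. by move=> [/(_ v) [_ + _] _]; apply. Qed.

Lemma orn_up d v x y :
  ornamentation d -> x \in d v -> le x y -> le y v -> y \in d v.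
Proof. by move=> [dro _]; apply: rooted_ornament_up. Qed.

Lemma orn_sub d v x y : ornamentation d -> x \in d v -> y \in d x -> y \in d v.
Proof. by move=> [_ dsub] /dsub /subsetP; apply. Qed.

(** The third clause of [leaf_block] keeps the rest of [d v] closed under parents. With the fourth,
    no [d x] with [x != v] in the rest meets [d u]: either [x] is below [u] and so in [d u], or [u]
    is in [d x] and so [x = u]. *)
Lemma remove_block_orn d v u :
  ornamentation d -> leaf_block d v u -> ornamentation (remove_block d v u).
Proof.
move=> od [uv nuv lf mx]; split=> [w | x w]; rewrite !ffunE.
  case: eqP => [-> | _]; last by case: od.
  split=> [|x /setDP [xv _]|x /setDP [xv xu] nxv].
  - rewrite inE (orn_self _ od) andbT; apply: contra nuv => /(orn_le_top od) lvu.
    by rewrite (tle_anti lvu (orn_le_top od uv)).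
  - exact: orn_le_top xv.
  have lxv := orn_le_top od xv.
  have pv : par x \in d v by case: od => /(_ v) [_ _ h] _; apply: h.
  rewrite inE pv andbT; apply: contra xu => pu; apply: lf => //.
  by apply: tle_trans (tle_par x) _; apply: orn_le_top pu.
case: (eqVneq w v) => [_ | nwv]; case: (eqVneq x v) => [-> // | nxv].
- move=> /setDP [xv xu]; apply/subsetP=> y yx; rewrite inE (orn_sub od xv yx) andbT.
  apply: contra xu => yu.
  have /orP [lxu | lux] := tle_up_total (orn_le_top od yx) (orn_le_top od yu).
    exact: lf.
  have ux : u \in d x by apply: orn_up od yx (orn_le_top od yu) lux.
  by rewrite (mx x) // orn_self.
- move=> vw; apply/subsetP=> y /setDP [yv _]; exact: orn_sub yv.
by move=> xw; apply/subsetP=> y; apply: orn_sub.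
Qed.

Lemma orn_leP (d e : {ffun T -> {set T}}) :
  reflect (forall v, d v \subset e v) (orn_le d e).
Proof. exact: forallP. Qed.

Lemma remove_block_lt d v u :
  ornamentation d -> leaf_block d v u -> orn_lt (remove_block d v u) d.
Proof.
move=> od [uv _ _ _]; apply/andP; split.
  by apply/orn_leP=> w; rewrite ffunE; case: eqP => [-> | _]; rewrite ?subsetDl.
apply/eqP=> /ffunP /(_ v) /setP /(_ u).
by rewrite ffunE eqxx inE uv orn_self.
Qed.

Lemma exists_top d w u : ornamentation d -> u \in d w -> u != w ->
  exists y, [/\ y \in d w, y != w, u \in d y &
               forall z, z \in d w -> z != w -> y \in d z -> z = y].
Proof.
move=> od uw nuw; pose P := [pred y | [&& y \in d w, y != w & u \in d y]].
have Pu : P u by rewrite /= uw nuw orn_self.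
case: (arg_minnP dp Pu) => y /and3P [yw nyw uy] ymin; exists y; split=> // z zw nzw yz.
apply/eqP/negPn/negP; rewrite eq_sym => /(depth_lt (orn_le_top od yz)).
by rewrite ltnNge ymin //= zw nzw (orn_sub od yz).
Qed.

(** The sets of the top nodes partition [d w] minus [w]. A deepest top node below [u] is a leaf
    block: a node of [d w] under it lies in the set of some top node, which is comparable to it and
    can be neither strictly lower nor strictly higher. *)
Lemma exists_leaf_block d w u : ornamentation d -> u \in d w -> u != w ->
    (forall y, y \in d w -> y != w -> le u y -> u != y ->
       ~~ (d w :&: Dl u \subset d y)) ->
  exists2 z, leaf_block d w z & le z u.
Proof.
move=> od uw nuw hu.
pose top z := [&& z \in d w, z != w &
  [forall y, [&& y \in d w, y != w & z \in d y] ==> (y == z)]].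
have topI z : z \in d w -> z != w ->
    (forall y, y \in d w -> y != w -> z \in d y -> y = z) -> top z.
  move=> zw nzw zm; apply/and3P; split=> //.
  by apply/forallP=> y; apply/implyP=> /and3P [yw nyw zy]; apply/eqP; apply: zm.
have topE z y : top z -> y \in d w -> y != w -> z \in d y -> y = z.
  move=> /and3P [_ _ /forallP /(_ y) h] yw nyw zy.
  by move: h; rewrite yw nyw zy => /eqP.
have topD a b x : top a -> top b -> x \in d a -> x \in d b -> a = b.
  move=> ta tb xa xb; have /and3P [aw naw _] := ta; have /and3P [bw nbw _] := tb.
  have /orP [lab | lba] := tle_up_total (orn_le_top od xa) (orn_le_top od xb).
    by rewrite (topE a b) // (orn_up od xb) ?(orn_le_top od xa).
  by rewrite (topE b a) // (orn_up od xa) ?(orn_le_top od xb).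
have [x0 tx0 lx0] : exists2 z, top z & le z u.
  have [y [yw nyw uy ym]] := exists_top od uw nuw.
  have ty : top y by apply: topI.
  case: (eqVneq y u) => [<- | nyu]; first by exists y; rewrite ?tle_refl.
  have luy := orn_le_top od uy.
  (* The block of [u] has its top [y] strictly above [u], so the hypothesis gives an [x] below [u]
     outside [d y]; the block of [x] has its top below [u], else it would share [u] with [d y]. *)
  have := hu y yw nyw luy; rewrite eq_sym => /(_ nyu) /subsetPn [x].
  rewrite !inE => /andP [xw lxu] xy.
  have nxw : x != w.
    apply: contra nuw => /eqP xw'; rewrite xw' in lxu.
    by rewrite (tle_anti lxu (orn_le_top od uw)).
  have [x' [x'w nx'w xx' x'm]] := exists_top od xw nxw.
  have tx' : top x' by apply: topI.
  exists x' => //.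
  have /orP [// | lux'] := tle_up_total (orn_le_top od xx') lxu.
  case/negP: xy; rewrite (topD y x' u) //; exact: orn_up xx' lxu lux'.
have Px0 : [pred z | top z && le z u] x0 by rewrite /= tx0.
case: (arg_maxnP dp Px0) => z /andP [tz lzu] zmax; exists z => //.
have /and3P [zw nzw _] := tz; split=> // [y yw lyz|y]; last exact: topE.
have nyw : y != w.
  apply: contra nzw => /eqP yw'; rewrite yw' in lyz.
  by rewrite (tle_anti lyz (orn_le_top od zw)).
have [y' [y'w ny'w yy' y'm]] := exists_top od yw nyw.
have ty' : top y' by apply: topI.
have /orP [lzy' | ly'z] := tle_up_total lyz (orn_le_top od yy').
  by rewrite -(topE z y') // (orn_up od yy').
case: (eqVneq y' z) => [<- // | ny'z].
have := depth_lt ly'z ny'z; rewrite ltnNge => /negP; case; apply: zmax.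
by rewrite /= ty' (tle_trans ly'z).
Qed.

(** At a deepest [v] where [e] and [d] differ, they agree at the top [u0] of the block of a lost
    element, so [u0] is not in [e v]. Then nothing below [u0] is in [e v], in particular no leaf
    block found there. *)
Lemma orn_lt_remove_block (e d : {ffun T -> {set T}}) :
    ornamentation e -> ornamentation d -> orn_lt e d ->
  exists v u, leaf_block d v u /\ orn_le e (remove_block d v u).
Proof.
move=> oe od /andP [/orn_leP led ned].
have [v0 Pv0] : exists v, e v != d v.
  apply/existsP; apply: contraR ned => /existsPn h.
  by apply/eqP/ffunP=> v; apply/eqP/negPn/h.
case: (@arg_maxnP _ v0 [pred v | e v != d v] dp Pv0) => v /= nv vmax.
have [x xv xev] : exists2 x, x \in d v & x \notin e v.
  by apply/subsetPn; apply: contra nv => h; rewrite eqEsubset led.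
have nxv : x != v by apply: contraNneq xev => ->; apply: orn_self.
have [u0 [u0v nu0v xu0 u0m]] := exists_top od xv nxv.
have eu0 : e u0 = d u0.
  apply/eqP/negPn/negP => /vmax; rewrite /geq /= leqNgt => /negP; case.
  by apply: depth_lt nu0v; apply: orn_le_top od u0v.
have u0ev : u0 \notin e v.
  by apply: contra xev => u0ev; apply: (orn_sub oe u0ev); rewrite eu0.
have [y yv nyv lu0y nu0y|u lb luu0] := exists_leaf_block od u0v nu0v.
  apply: contra nu0y => /subsetP /(_ u0); rewrite !inE u0v tle_refl => /(_ isT) h.
  by rewrite (u0m y).
exists v, u; split=> //; apply/orn_leP=> w; rewrite ffunE.
case: eqP => [-> | //]; apply/subsetP=> p pv; rewrite inE (subsetP (led v)) // andbT.
apply: contra u0ev => pu; apply: (orn_up oe pv _ (orn_le_top od u0v)).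
by apply: tle_trans luu0; apply: orn_le_top pu.
Qed.

Lemma orn_le_anti (d e : {ffun T -> {set T}}) : orn_le d e -> orn_le e d -> d = e.
Proof.
move=> /orn_leP de /orn_leP ed; apply/ffunP=> v; apply/eqP.
by rewrite eqEsubset de ed.
Qed.

(** An intermediate [e] can differ only at [v]. If [u] is in [e v], so is all of [e u = d u]; if
    not, upward closure keeps [d u] out of [e v]. *)
Lemma remove_block_cover d v u :
  ornamentation d -> leaf_block d v u -> orn_cover par (remove_block d v u) d.
Proof.
move=> od lb; have [uv nuv _ _] := lb; apply/and4P; split.
- exact/ornamentationP/remove_block_orn.
- exact/ornamentationP.
- exact: remove_block_lt.
apply/forallP=> e; apply/negP => /and3P [/ornamentationP oe].
move=> /andP [lre nre] /andP [led ned].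
have eE w : w != v -> e w = d w.
  move=> nwv; apply/eqP; rewrite eqEsubset (orn_leP _ _ led).
  by have := orn_leP _ _ lre w; rewrite ffunE (negPf nwv).
have := orn_leP _ _ lre v; rewrite ffunE eqxx => sub.
case: (boolP (u \in e v)) => uev.
  case/eqP: ned; apply: orn_le_anti led _; apply/orn_leP=> w.
  case: (eqVneq w v) => [-> | /eE -> //]; apply/subsetP=> x xv.
  case: (boolP (x \in d u)) => xu; last by apply: (subsetP sub); rewrite inE xu.
  by apply: orn_sub uev _ => //; rewrite eE.
case/eqP: nre; apply: orn_le_anti lre _; apply/orn_leP=> w.
rewrite ffunE; case: (eqVneq w v) => [-> | /eE -> //]; apply/subsetP=> x xv.
rewrite inE (subsetP (orn_leP _ _ led v)) // andbT; apply: contra uev => xu.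
by apply: (orn_up oe xv); [apply: orn_le_top xu | apply: orn_le_top uv].
Qed.

(** Block removals are lower covers, and by [orn_lt_remove_block] there are no others, so the meet
    deletes exactly the leaf blocks. *)
Lemma PopP d v x : ornamentation d ->
  x \in Pop par d v <-> x \in d v /\ (forall u, leaf_block d v u -> x \notin d u).
Proof.
move=> od; rewrite ffunE inE; split=> [/andP [xv /bigcapP h] | [xv h]].
  split=> // u lb; have := h _ (remove_block_cover od lb).
  by rewrite ffunE eqxx inE => /andP [].
rewrite xv; apply/bigcapP=> d' /and4P [/ornamentationP od' _ ltd' /forallP nobetw].
have [w [u [lb led']]] := orn_lt_remove_block od' od ltd'.
have -> : d' = remove_block d w u.
  apply/eqP; have := nobetw (remove_block d w u); rewrite negb_and => /orP [].
    by move=> /negP; case; apply/ornamentationP; apply: remove_block_orn.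
  by rewrite remove_block_lt // andbT /orn_lt led' negbK.
rewrite ffunE; case: eqP => [vw | //]; rewrite vw in xv h *.
by rewrite inE xv h.
Qed.

Lemma Pop_sub d v : Pop par d v \subset d v.
Proof. by rewrite ffunE subsetIl. Qed.

Lemma Pop_orn d : ornamentation d -> ornamentation (Pop par d).
Proof.
move=> od; split=> [v | x v /PopP -/(_ od) [xv hx]].
  split=> [|x /(subsetP (Pop_sub _ _))|x /PopP -/(_ od) [xv hx] nxv].
  - apply/PopP => //; split=> [|u [uv nuv _ _]]; first exact: orn_self.
    apply: contra nuv => /(orn_le_top od) lvu.
    by rewrite (tle_anti lvu (orn_le_top od uv)).
  - exact: orn_le_top.
  apply/PopP => //; split=> [|u lb].
    by case: od => /(_ v) [_ _ h] _; apply: h.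
  apply: contra (hx u lb) => pu; case: lb => _ _ lf _; apply: lf => //.
  by apply: tle_trans (tle_par x) _; apply: orn_le_top pu.
apply/subsetP=> y /PopP -/(_ od) [yx hy]; apply/PopP => //.
split=> [|u lb]; first exact: orn_sub xv yx.
have [uv nuv lf mx] := lb.
apply: contra (hx u lb) => yu.
have /orP [lxu | lux] := tle_up_total (orn_le_top od yx) (orn_le_top od yu).
  exact: lf.
have ux : u \in d x by apply: orn_up od yx (orn_le_top od yu) lux.
case: (eqVneq x v) => [xv' | nxv]; last by rewrite (mx x) // orn_self.
by rewrite xv' in hy; case/negP: (hy u lb).
Qed.

Lemma Pop_loses d w u : ornamentation d -> u \in d w -> u != w ->
    (forall y, y \in d w -> y != w -> le u y -> u != y ->
       ~~ (d w :&: Dl u \subset d y)) ->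
  exists x, [/\ x \in d w, le x u & x \notin Pop par d w].
Proof.
move=> od uw nuw hu; have [z lb lzu] := exists_leaf_block od uw nuw hu.
have [zw _ _ _] := lb; exists z; split=> //.
by apply/negP => /PopP -/(_ od) [_ /(_ z lb)]; rewrite orn_self.
Qed.

(** The child of [w] on the way to another element of [d w] meets the criterion of [Pop_loses]
    vacuously: no node lies strictly between it and [w]. *)
Lemma Pop_proper d w : ornamentation d -> d w != [set w] -> Pop par d w \proper d w.
Proof.
move=> od nd; apply/properP; split; first exact: Pop_sub.
have [x xw nxw] : exists2 x, x \in d w & x != w.
  apply/exists_inP; apply: contraR nd => /exists_inPn h.
  apply/eqP/setP=> x; rewrite inE; apply/idP/eqP => [/h /negPn /eqP // | ->].
  exact: orn_self.
have [c [pc ncw lxc]] := tle_child (orn_le_top od xw) nxw.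
have lcw : le c w by rewrite -pc tle_par.
have [y yw nyw lcy ncy|z [zw _ zP]] := Pop_loses od (orn_up od xw lxc lcw) ncw.
  have := tle_below_child lcy; rewrite eq_sym ncy pc => /(_ isT) lwy.
  by case/eqP: nyw; apply: tle_anti lwy; apply: orn_le_top yw.
by exists z.
Qed.

(** * Upper bound: survival times of nodes under iteration *)

Lemma iter_Pop_orn t d : ornamentation d -> ornamentation (iter t (Pop par) d).
Proof. by move=> od; elim: t => //= t IH; apply: Pop_orn. Qed.

(** The count of survivors below [u] makes the induction close. Either one of them is lost, which
    pays for the step, or all of them lie in the set of some [y] strictly between [u] and [w], and
    the bound for [y] one step earlier suffices because [y] is deeper than [w]. *)
Lemma time_bound d t w u : ornamentation d -> u != w -> u \in iter t (Pop par) d w ->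
  #|iter t (Pop par) d w :&: Dl u| + t.+1 + dp w <= #|Dl u| + dp u.
Proof.
move=> od; elim: t w u => [|t IH] w u nuw.
  move=> uw; have := depth_lt (orn_le_top od uw) nuw.
  by have := subset_leq_card (subsetIr (d w) (Dl u)); move=> /=; lia.
rewrite iterS; have oe := iter_Pop_orn t od; move: (iter t _ d) oe IH => e oe IH uP.
have uw := subsetP (Pop_sub e w) _ uP.
have sub : Pop par e w :&: Dl u \subset e w :&: Dl u by apply: setSI; apply: Pop_sub.
case: (boolP [exists y in e w, [&& y != w, le u y, u != y & e w :&: Dl u \subset e y]]).
  case/exists_inP=> y yw /and4P [nyw luy nuy suby].
  have uy : u \in e y by apply: (subsetP suby); rewrite !inE uw tle_refl.
  have := IH y u nuy uy; have := depth_lt (orn_le_top oe yw) nyw.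
  have : Pop par e w :&: Dl u \subset e y :&: Dl u.
    by rewrite subsetI subsetIr andbT; apply: subset_trans suby.
  by move/subset_leq_card; lia.
move=> /exists_inPn h.
have [y yw nyw luy nuy|x [xw lxu xP]] := Pop_loses oe uw nuw.
  by have := h y yw; rewrite nyw luy nuy.
have : Pop par e w :&: Dl u \proper e w :&: Dl u.
  apply/properP; split=> //; exists x; rewrite !inE ?xw ?lxu //.
  by rewrite (negPf xP).
by move/proper_card; have := IH w u nuw uw; lia.
Qed.

Lemma time_bound_mem d t w u : ornamentation d -> u != w ->
  u \in iter t (Pop par) d w -> t.+2 + dp w <= #|Dl u| + dp u.
Proof.
move=> od nuw uw; have := time_bound od nuw uw.
have : 0 < #|iter t (Pop par) d w :&: Dl u|; last by lia.
by apply/card_gt0P; exists u; rewrite !inE uw tle_refl.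
Qed.

Section UpperBound.
Variables (M : nat) (d : {ffun T -> {set T}}).
Hypothesis od : ornamentation d.
(** [M.+1] stands for the right-hand side of the theorem, and [M.+2] moves its [- 1] across. A node
    [a] as here is called good below. *)
Hypothesis leaf_bound : forall l, l != r -> Dl l = [set l] ->
  exists a, [/\ le l a, a != r & #|Dl a| + 2 * dp a <= M.+2].

(** The hypothesis says that no proper non-root ancestor of [v] is good. A good [v] is settled by
    [time_bound_mem]; otherwise the hypothesis passes to the children of [v]. The first conjunct
    serves to settle time 0. *)
Lemma gone_from v : v != r ->
    (forall a, le v a -> v != a -> a != r -> M.+2 < #|Dl a| + 2 * dp a) ->
  2 * dp v <= M.+1 /\
  forall t w, v != w -> M.+1 <= t + dp v + dp w -> v \notin iter t (Pop par) d w.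
Proof.
have [n] := ubnP #|Dl v|; elim: n v => // n IHn v lt_n nvr hv.
have [gv | gv] := leqP (#|Dl v| + 2 * dp v) M.+2.
  have Dv := card_Delta_gt0 v; split=> [|t w nvw hM]; first by lia.
  apply/negP => /(time_bound_mem od nvw).
  by lia.
have IHc c : par c = v -> c != v -> 2 * dp c <= M.+1 /\
    forall t w, c != w -> M.+1 <= t + dp c + dp w -> c \notin iter t (Pop par) d w.
  move=> pc ncv; have lcv : le c v by rewrite -pc tle_par.
  apply: IHn => [|| a lca nca nar].
  - by apply: leq_trans (card_Delta_lt lcv ncv) _.
  - exact: tle_lt_neq_root lcv ncv.
  have lva : le v a by rewrite -pc; apply: tle_below_child; rewrite // eq_sym.
  by case: (eqVneq v a) => [<- // | nva]; apply: hv.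
(* A leaf that is not good would have a good proper ancestor, which [hv] excludes. *)
have [x lxv nxv] : exists2 x, le x v & x != v.
  case: (eqVneq (Dl v) [set v]) => [lf | ].
    have [a [lva nar ha]] := leaf_bound nvr lf.
    case: (eqVneq v a) => [e | nva]; first by rewrite -e in ha; lia.
    by have := hv a lva nva nar; lia.
  rewrite eqEsubset sub1set inE tle_refl andbT => /subsetPn [x].
  by rewrite !inE; exists x.
have dc c : par c = v -> c != v -> dp c = (dp v).+1.
  by move=> pc; rewrite -pc; apply: depth_child.
have dv : 2 * (dp v).+1 <= M.+1.
  have [c [pc ncv _]] := tle_child lxv nxv.
  by rewrite -(dc c) //; case: (IHc c).
split=> [|t]; first by lia.
elim: t => [|t IHt] w nvw hM; apply/negP=> vP.
  by have := depth_lt (orn_le_top od vP) nvw; lia.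
move: vP; rewrite iterS => vP; have oe := iter_Pop_orn t od.
have vw := subsetP (Pop_sub _ w) _ vP.
have lvw := orn_le_top oe vw.
(* No [y] strictly between [v] and [w] still holds [v] at time [t]: its extra depth makes up for the
   missing step. *)
have [y yw nyw lvy nvy|z [zw lzv zP]] := Pop_loses oe vw nvw.
  apply: contra (IHt y nvy _) => [/subsetP h|]; first by apply: h; rewrite in_setI vw in_set tle_refl.
  by have := depth_lt (orn_le_top oe yw) nyw; lia.
case: (eqVneq z v) => [zv | nzv]; first by rewrite zv vP in zP.
(* The child of [v] above [z] would still be present, yet it is one deeper than [v], so its deadline
   comes one step earlier. *)
have [c [pc ncv lzc]] := tle_child lzv nzv.
have lcv : le c v by rewrite -pc tle_par.
have ncw : c != w.
  by apply: contra nvw => /eqP cw; rewrite cw in lcv; rewrite (tle_anti lvw lcv).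
have late : M.+1 <= t + dp c + dp w by rewrite dc // addnS -addSn.
have [_ gone] := IHc c pc ncv; have /negP := gone t w ncw late; apply.
exact: orn_up oe zw lzc (tle_trans lcv lvw).
Qed.

(** No child [c] of [w] can be present at time [M]. If a good [a] is at or above [w], then
    [#|Delta c| < #|Delta a| <= M] contradicts [time_bound_mem]; otherwise [gone_from] applies to
    [c]. *)
Lemma iter_Pop_bottom w : iter M (Pop par) d w = [set w].
Proof.
have oe := iter_Pop_orn M od.
apply/setP=> x; rewrite inE; apply/idP/eqP => [xw | ->]; last exact: orn_self.
apply/eqP/negPn/negP => nxw.
have [c [pc ncw lxc]] := tle_child (orn_le_top oe xw) nxw.
have lcw : le c w by rewrite -pc tle_par.
have cw := orn_up oe xw lxc lcw.
have dc : dp c = (dp w).+1 by rewrite -pc depth_child // pc.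
have ncr := tle_lt_neq_root lcw ncw.
case: (boolP [exists a, [&& le w a, a != r & #|Dl a| + 2 * dp a <= M.+2]]).
  case/existsP=> a /and3P [lwa nar ha].
  have := time_bound_mem od ncw cw; have := depth_gt0 nar.
  have nca : c != a.
    by apply: contra ncw => /eqP ca; rewrite -ca in lwa; rewrite (tle_anti lcw lwa).
  by have := card_Delta_lt (tle_trans lcw lwa) nca; lia.
move=> /existsPn h; have [a lca nca nar|_] := gone_from ncr.
  have lwa : le w a by rewrite -pc; apply: tle_below_child; rewrite // eq_sym.
  by have := h a; rewrite lwa nar -ltnNge.
have late : M.+1 <= M + dp c + dp w by rewrite dc addnS addSn ltnS -addnA leq_addr.
by move=> gone; have /negP := gone M w ncw late.
Qed.

Lemma card_orbit_le : #|orbit_pop par d| <= M.+1.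
Proof.
have st t : M <= t -> iter t (Pop par) d = iter M (Pop par) d.
  move=> Mt; rewrite -(subnK Mt) iterD; elim: (t - M) => //= k ->.
  apply/ffunP=> w; apply/eqP; rewrite eqEsubset Pop_sub iter_Pop_bottom sub1set.
  by apply: orn_self; apply: Pop_orn; apply: iter_Pop_orn.
rewrite -[M.+1]card_ord -cardsT.
apply: leq_trans (leq_imset_card (fun t : 'I_M.+1 => iter t (Pop par) d) _).
apply/subset_leq_card/subsetP=> e; rewrite inE => he.
rewrite -(iter_findex he); have [lt | ge] := ltnP (findex (Pop par) d e) M.+1.
  by apply/imsetP; exists (Ordinal lt).
by apply/imsetP; exists ord_max; rewrite //= st // ltnW.
Qed.
End UpperBound.

(** * Lower bound: a slowly decaying ornamentation along a branch *)

Lemma Pop_local d e c : ornamentation d -> ornamentation e ->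
    (forall x, le x c -> d x = e x) ->
  forall x, le x c -> Pop par d x = Pop par e x.
Proof.
wlog suff half : d e / ornamentation d -> ornamentation e ->
    (forall x, le x c -> d x = e x) ->
    forall x, le x c -> Pop par d x \subset Pop par e x.
  move=> od oe de x lxc; apply/eqP; rewrite eqEsubset !half // => y lyc.
  by rewrite de.
move=> od oe de x lxc; apply/subsetP=> y /PopP -/(_ od) [yx hy].
apply/PopP => //; split=> [|u [ux nux lf mx]]; first by rewrite -de.
have bel w : w \in e x -> le w c by move/(orn_le_top oe)/tle_trans; apply.
rewrite -de ?bel //; apply: hy; split; rewrite ?de //.
  by rewrite bel.
move=> w wx nwx; rewrite de ?bel //; exact: mx.
Qed.

(** The sets at nodes below [c] evolve independently of the rest, so a set placed at the parent of
    [c] does not disturb the history of [d c]. *)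
Lemma iter_Pop_local d e c t : ornamentation d -> ornamentation e ->
    (forall x, le x c -> d x = e x) ->
  forall x, le x c -> iter t (Pop par) d x = iter t (Pop par) e x.
Proof.
move=> od oe de; elim: t => //= t IH.
by apply: Pop_local IH; apply: iter_Pop_orn.
Qed.

(* The block of [c] has the block of [z] below it, hence is not a leaf block. *)
Lemma Pop_keeps_child e v c z : ornamentation e -> c \in e v -> c != v ->
    (forall x, x \in e v -> x != v -> le x c) ->
    z \in e v -> z != v -> z \notin e c ->
  e c \subset Pop par e v.
Proof.
move=> oe cv ncv hc zv nzv zc; apply/subsetP=> x xc; apply/PopP => //.
split=> [|u [uv nuv lf mx]]; first exact: orn_sub cv xc.
apply/negP => xu; have luc := hc u uv nuv.
have uc : u \in e c by apply: orn_up oe xc (orn_le_top oe xu) luc.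
have cu : c = u by apply: mx.
by case/negP: zc; rewrite cu; apply: lf => //; rewrite -cu; apply: hc.
Qed.

Definition singletons : {ffun T -> {set T}} := [ffun x => [set x]].

Lemma singletons_orn : ornamentation singletons.
Proof.
split=> [v|x v]; rewrite !ffunE ?inE; last by move/eqP->.
split=> [|x|x]; rewrite !inE ?eqxx //; first by move/eqP->; apply: tle_refl.
by move=> ->.
Qed.

Definition set_at (d : {ffun T -> {set T}}) (v : T) (A : {set T}) :
  {ffun T -> {set T}} := [ffun w => if w == v then v |: A else d w].

(** Since [d] is trivial outside [d c], the node [v] lies in no set but its own, so enlarging the
    set at [v] only requires that the new set absorb those of its members. *)
Lemma set_at_orn d c v (A : {set T}) : ornamentation d -> par c = v -> c != v ->
    (forall x, x \notin d c -> d x = [set x]) ->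
    (forall x, x \in A -> [/\ le x c, x = c \/ par x \in A & d x \subset A]) ->
  ornamentation (set_at d v A).
Proof.
move=> od pc ncv ds hA.
have lcv : le c v by rewrite -pc tle_par.
have notlvc : ~ le v c by move=> lvc; case/eqP: ncv; apply: tle_anti.
split=> [w | x w]; rewrite !ffunE.
  case: eqP => [-> | _]; last by case: od.
  split=> [|x|x]; rewrite !inE ?eqxx //.
    move=> /orP [/eqP -> | /hA [lxc _ _]]; first exact: tle_refl.
    exact: tle_trans lcv.
  move=> /orP [/eqP -> | /hA [_ [-> | pA] _] _]; rewrite ?eqxx //.
    by rewrite pc eqxx.
  by rewrite pA orbT.
case: (eqVneq w v) => [_ | nwv].
  rewrite !inE => /orP [-> // | xA]; case: eqP => // _.
  by have [_ _ sub] := hA x xA; apply: subset_trans sub _; apply: subsetU1.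
move=> xw; case: (eqVneq x v) => [xv | _]; last by case: od => _; apply.
rewrite xv in xw; case/eqP: nwv; have := xw; rewrite ds ?inE; first by move/eqP.
apply/negP => wc; apply: notlvc.
exact: tle_trans (orn_le_top od xw) (orn_le_top od wc).
Qed.

(** Passing from [v] to its child lowers [k] by 2 and raises [2 * dp v] by 2, so the hypothesis on
    [u] is inherited. The bound on [#|d v|] leaves room for a new node one level up, and triviality
    outside [d v] feeds [set_at_orn]. *)
Lemma slow_ornamentation l k v : Dl l = [set l] -> le l v -> (0 < k -> l != v) ->
    (forall u, le l u -> le u v -> u != v -> k.+2 + 2 * dp v <= #|Dl u| + 2 * dp u) ->
  exists d, [/\ ornamentation d, (forall x, x \notin d v -> d x = [set x]),
    #|d v| <= k.+1 & forall t, t < k -> iter t (Pop par) d v != [set v]].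
Proof.
move=> lf; have [n] := ubnP k; elim: n k v => // n IHn k v.
case: k => [_ _ _ _|k lt_n llv nlv hu].
  exists singletons; split=> // [|x _|]; rewrite ?ffunE ?cards1 //.
  exact: singletons_orn.
have [c [pc ncv llc]] := tle_child llv (nlv isT).
have lcv : le c v by rewrite -pc tle_par.
have dc : dp c = (dp v).+1 by rewrite -pc depth_child // pc.
have vNc x : le x c -> x != v.
  move=> lxc; apply: contra ncv => /eqP xv; rewrite xv in lxc.
  by rewrite (tle_anti lcv lxc).
case: k => [|k] in lt_n nlv hu *.
  exists (set_at singletons v [set c]); split=> [|x||[]//].
  - apply: (set_at_orn singletons_orn pc ncv) => [x _|x]; first by rewrite ffunE.
    by rewrite inE ffunE => /eqP ->; rewrite tle_refl; split=> //; left.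
  - by rewrite !ffunE eqxx; case: eqP => // ->; rewrite !inE eqxx.
  - by rewrite ffunE eqxx cards2; case: (_ != _).
  move=> _; apply: contraNneq ncv; rewrite /= ffunE eqxx => /setP /(_ c).
  by rewrite !inE eqxx orbT => <-.
(* The hypothesis at [u = c] makes [Delta c] larger than the bound [k.+1] on [#|d c|]. *)
have ltc : k.+2 < #|Dl c|.+1 by have := hu c llc lcv ncv; rewrite dc; lia.
have [|_|u llu luc nuc|d [od ds dk dt]] := IHn k c _ llc.
- by lia.
- by apply: contraTneq ltc => <-; rewrite lf cards1; lia.
- have := hu u llu (tle_trans luc lcv) (vNc u luc); rewrite dc; lia.
have [y [lyc ydc pyd]] : exists y, [/\ le y c, y \notin d c & par y \in d c].
  have [y0 y0c y0d] : exists2 y, y \in Dl c & y \notin d c.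
    by apply/subsetPn; apply: contraTN ltc => /subset_leq_card; lia.
  have Py0 : [pred y | (y \in Dl c) && (y \notin d c)] y0 by rewrite /= y0c.
  (* Least depth outside [d c] puts the parent of [y] inside [d c]. *)
  case: (arg_minnP dp Py0) => y /andP [yc yd] ymin; rewrite inE in yc; exists y; split=> //.
  have nyc : y != c by apply: contraNneq yd => ->; apply: orn_self.
  have := depth_child (par_neq (tle_lt_neq_root yc nyc)).
  have : le (par y) c by move: yc; rewrite tle_eqVpar (negPf nyc).
  move=> lpc dpy; apply/negPn/negP => pyd.
  by have := ymin (par y); rewrite /= inE lpc pyd dpy ltnn => /(_ isT).
pose A := y |: d c; pose e := set_at d v A.
have oe : ornamentation e.
  apply: (set_at_orn od pc ncv ds) => x /setU1P [-> | xd].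
    by rewrite !inE pyd orbT (ds y ydc) sub1set setU11; split=> //; right.
  split; first exact: orn_le_top xd.
    case: (eqVneq x c) => [-> | nxc]; [by left | right].
    by rewrite inE orbC; case: od => /(_ c) [_ _ ->].
  by apply: subset_trans (subsetUr _ _); case: od => _; apply.
have eD t : iter t (Pop par) e c = iter t (Pop par) d c.
  apply: iter_Pop_local (tle_refl c) => // x lxc.
  by rewrite ffunE (negPf (vNc x lxc)).
have ev : e v = v |: A by rewrite ffunE eqxx.
have ebel t x : x \in iter t (Pop par) e v -> x != v -> le x c.
  have sub : iter t (Pop par) e v \subset e v.
    by elim: t => //= t IH; apply: subset_trans IH; apply: Pop_sub.
  move=> /(subsetP sub); rewrite ev !inE => /or3P [/eqP -> | /eqP -> // | xd _].
    by rewrite eqxx.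
  exact: orn_le_top xd.
have cIn t : c \in iter t (Pop par) e c by apply: orn_self; apply: iter_Pop_orn.
have step t z : iter t (Pop par) e c \subset iter t (Pop par) e v ->
    z \in iter t (Pop par) e v -> z != v -> z \notin iter t (Pop par) e c ->
    iter t (Pop par) e c \subset iter t.+1 (Pop par) e v.
  move=> sub zv nzv zc; apply: (Pop_keeps_child (z := z)) => //.
  - exact: iter_Pop_orn.
  - exact: (subsetP sub).
  - exact: ebel.
(* The extra node [z] is renewed at each step: what the set at [c] loses is kept by the set at [v],
   through [Pop_keeps_child]. *)
have inv t : t <= k -> iter t (Pop par) e c \subset iter t (Pop par) e v /\
    exists z, [/\ z \in iter t (Pop par) e v, z != v & z \notin iter t (Pop par) e c].
  elim: t => [_ | t IH tk].
    rewrite /iter ev ffunE (negPf ncv) /A; split; last first.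
      by exists y; rewrite !inE eqxx orbT (vNc y lyc).
    by apply: subset_trans (subsetUr _ _); apply: subsetUr.
  have [sub [z [zv nzv zc]]] := IH (ltnW tk).
  have keep := step t z sub zv nzv zc.
  have /properP [psub [z' z'c z'P]] : iter t.+1 (Pop par) e c \proper iter t (Pop par) e c.
    by apply: Pop_proper; [apply: iter_Pop_orn | rewrite eD dt].
  split; first exact: subset_trans keep.
  exists z'; split=> //; first exact: (subsetP keep).
  by apply: vNc; apply: orn_le_top z'c; apply: iter_Pop_orn.
exists e; split=> // [x||t].
- rewrite ev !inE !negb_or => /and3P [nxv _ xd].
  by rewrite ffunE (negPf nxv) ds.
- by rewrite ev /A !cardsU1; move: dk; case: (_ \in _) => /=; case: (_ \in _) => /=; lia.
(* At time [k.+1], one step past the invariant, the set at [v] still contains [c]. *)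
rewrite ltnS leq_eqVlt => /orP [/eqP -> | tk].
  have [sub [z [zv nzv zc]]] := inv k (leqnn k).
  apply: contraNneq ncv => kv; have := subsetP (step k z sub zv nzv zc) c (cIn k).
  by rewrite kv inE.
have [_ [z [zv nzv _]]] := inv t tk.
by apply: contraNneq nzv => tv; rewrite tv inE in zv.
Qed.

(** Until it is a singleton the set at [v] shrinks strictly, so times 0 to [k] give distinct
    ornamentations. *)
Lemma card_orbit_ge k d v : ornamentation d ->
  (forall t, t < k -> iter t (Pop par) d v != [set v]) -> k < #|orbit_pop par d|.
Proof.
move=> od hd.
have lt_card i j : i < j -> j <= k ->
    #|iter j (Pop par) d v| < #|iter i (Pop par) d v|.
  elim: j => // j IH; rewrite ltnS leq_eqVlt => ij jk.
  have : #|iter j.+1 (Pop par) d v| < #|iter j (Pop par) d v|.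
    by apply/proper_card/Pop_proper; [apply: iter_Pop_orn | apply: hd].
  by case/orP: ij => [/eqP -> // | ij] /ltn_trans; apply; apply: IH (ltnW jk).
pose f (t : 'I_k.+1) := iter t (Pop par) d.
have f_inj : injective f.
  move=> i j fij; apply/val_inj/eqP => /=; apply/negPn; rewrite neq_ltn; apply/negP.
  by case/orP => /lt_card; rewrite -ltnS ltn_ord -/(f i) -/(f j) fij ltnn => /(_ isT).
rewrite -[k.+1]card_ord -(card_imset _ f_inj).
apply/subset_leq_card/subsetP=> _ /imsetP [t _ ->]; rewrite inE.
exact: fconnect_iter.
Qed.

(** * Maximal chains as paths from leaves to the root *)

Lemma Nabla_maxchain l : Dl l = [set l] -> is_maxchain par (Nabla par l).
Proof.
move=> lf; apply/andP; split.
  apply/forall_inP=> x; rewrite inE => lx; apply/forall_inP=> y; rewrite inE => ly.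
  exact: tle_up_total lx ly.
apply/forallP=> D; apply/implyP=> /andP [/forall_inP chD sub].
rewrite eqEsubset sub andbT; apply/subsetP=> x xD; rewrite inE.
have lD : l \in D by apply: (subsetP sub); rewrite inE tle_refl.
have /forall_inP /(_ x xD) /orP [// | lxl] := chD l lD.
have : x \in Dl l by rewrite inE.
by rewrite lf inE => /eqP ->; apply: tle_refl.
Qed.

(** A deepest [l] in the chain lies below all its elements, so maximality gives [C = Nabla par l]; a
    node strictly below [l] would give a longer chain. *)
Lemma maxchain_leaf C : is_maxchain par C ->
  exists2 l, Dl l = [set l] & C = Nabla par l.
Proof.
move=> /andP [/forall_inP chC /forallP mxC].
have chN l : is_chain par (Nabla par l).
  apply/forall_inP=> x; rewrite inE => lx.
  by apply/forall_inP=> y; rewrite inE; apply: tle_up_total.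
have CN l : C \subset Nabla par l -> C = Nabla par l.
  by move=> sub; have := mxC (Nabla par l); rewrite chN sub => /eqP.
have [l0 l0C] : exists l, l \in C.
  apply/set0Pn/eqP => C0; have := CN r; rewrite C0 sub0set => /(_ isT) /setP /(_ r).
  by rewrite !inE tle_refl.
case: (arg_maxnP dp l0C) => l lC lmax.
have CNl : C = Nabla par l.
  apply: CN; apply/subsetP=> x xC; rewrite inE.
  have /forall_inP /(_ x xC) /orP [// | lxl] := chC l lC.
  case: (eqVneq x l) => [-> | nxl]; first exact: tle_refl.
  by have := depth_lt lxl nxl; rewrite ltnNge => /negP; case; apply: lmax.
exists l => //; apply/eqP; rewrite eqEsubset sub1set inE tle_refl andbT.
apply/subsetP=> x; rewrite !inE => lxl.
have : x \in C.
  rewrite (CN x) ?inE ?tle_refl // CNl.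
  by apply/subsetP=> y; rewrite !inE; apply: tle_trans.
by rewrite CNl inE => llx; rewrite (tle_anti lxl llx).
Qed.

Lemma leaf_neq_root l : 2 <= #|T| -> Dl l = [set l] -> l != r.
Proof.
move=> hT lf; apply: contraTneq hT => lr; rewrite -cardsT.
suff -> : setT = Dl l by rewrite lf cards1.
by apply/setP=> x; rewrite lr !inE; apply/esym/Htree.
Qed.

Lemma exists_leaf : exists l, Dl l = [set l].
Proof.
case: (@arg_maxnP _ r predT dp isT) => l _ lmax; exists l.
apply/setP=> x; rewrite !inE; apply/idP/eqP => [lxl | ->]; last exact: tle_refl.
apply/eqP/negPn/negP => /(depth_lt lxl); rewrite ltnNge => /negP; case.
exact: lmax.
Qed.

End TreeOrder.

(** * Minima over sets, and the equality of the two sides *)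

Lemma min_over_le (T : finType) (A : {set T}) (f : T -> nat) a :
  a \in A -> min_over A f <= f a.
Proof.
move=> aA; rewrite /min_over; move: (mem_index_enum a); move: (\max_(_ in _) _) => m.
elim: (index_enum T) => // b s IH; rewrite inE big_cons => /orP [/eqP <- | /IH le_s].
  by rewrite aA geq_minl.
by case: ifP => // _; apply: leq_trans (geq_minr _ _) le_s.
Qed.

(** The seed is itself a value of [f] on [A], so folding [minn] never leaves the set of values. *)
Lemma min_over_attained (T : finType) (A : {set T}) (f : T -> nat) :
  A != set0 -> exists2 a, a \in A & min_over A f = f a.
Proof.
rewrite -card_gt0 => /(eq_bigmax_cond f) [a0 a0A ea0]; rewrite /min_over.
apply: (big_ind (fun m => exists2 a, a \in A & m = f a)); first by exists a0.
- move=> _ _ [a aA ->] [b bA ->]; rewrite /minn.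
  by case: ifP => _; [exists a | exists b].
by move=> a aA; exists a.
Qed.

Theorem theorem1p1 (T : finType) (r : T) (par : T -> T)
  (Hroot : par r = r) (Htree : forall v : T, fconnect par v r)
  (Hn : 2 <= #|T|) :
  \max_(d : {ffun T -> {set T}} | is_ornamentation par d) #|orbit_pop par d|
  = \max_(C : {set T} | is_maxchain par C)
      min_over (C :\ r)
        (fun v => #|Delta par v| + 2 * depth par v - 1).
Proof.
set f := (fun v => #|Delta par v| + 2 * depth par v - 1); set R := (RHS in _ = RHS).
have R_leaf l : l != r -> Delta par l = [set l] ->
    exists a, [/\ tle par l a, a != r & f a <= R].
  move=> nlr lf; have mC := Nabla_maxchain lf.
  have ne : Nabla par l :\ r != set0.
    by apply/set0Pn; exists l; rewrite !inE nlr tle_refl.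
  have [a] := min_over_attained f ne; rewrite !inE => /andP [nar lla] ea.
  exists a; split=> //; rewrite -ea.
  exact: (leq_bigmax_cond (F := fun C => min_over (C :\ r) f)).
have [l0 lf0] := exists_leaf Hroot Htree.
have nl0 := leaf_neq_root Htree Hn lf0.
(* Positivity allows the upper bound to be applied with [M = R.-1]. *)
have R_gt0 : 0 < R.
  have [a [_ nar]] := R_leaf l0 nl0 lf0; apply: leq_trans.
  have := depth_gt0 Hroot Htree nar; rewrite /f; lia.
apply/eqP; rewrite eqn_leq; apply/andP; split; apply/bigmax_leqP.
  move=> d /(ornamentationP Hroot Htree) od.
  rewrite -(prednK R_gt0); apply: (card_orbit_le Hroot Htree od) => l nlr lf.
  have [a [lla nar ha]] := R_leaf l nlr lf; exists a; split=> //.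
  by move: ha; rewrite /f; lia.
move=> C mC; have [l lf ->] := maxchain_leaf Hroot Htree mC.
case: (posnP (min_over (Nabla par l :\ r) f)) => [-> // | m_gt0].
set m := min_over _ _ in m_gt0 *.
(* At the root, of depth 0, the hypothesis for [k = m.-1] reads [m <= f u], and [m.-1] surviving
   steps give at least [m] orbit elements. *)
have [||u llu _ nur|d [od _ _ hd]] :=
    slow_ornamentation Hroot Htree (k := m.-1) (v := r) lf.
- exact: Htree.
- by move=> _; apply: leaf_neq_root lf.
- have : m <= f u by apply: min_over_le; rewrite !inE nur llu.
  by rewrite (depth_root Hroot) /f; move: m_gt0; lia.
apply: leq_trans (leq_bigmax_cond (F := fun d => #|orbit_pop par d|) d _).
  by have := card_orbit_ge Hroot Htree od hd; rewrite prednK.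
exact/(ornamentationP Hroot Htree).
Qed.
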